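(* Let $N\ge 2$ be an integer and let $\lambda>0$, $p>0$, $F\neq 0$ and $-2<\alpha<2p$ be real constants. Then there exists at least one radial rupture solution $u=u(r)$, $r=|x|$, near the origin of $$\Delta u=\frac{\lambda|x|^{\alpha}}{u^{p}}+F,\qquad u>0 \text{ for } x\ne 0,\qquad u(0)=0,$$ satisfying, as $r\to0^+$, $$u(r)=\Lambda r^{\frac{\alpha+2}{p+1}}+\sum_{i=1}^{\infty}d_i\, r^{\frac{(2p-\alpha)i+(\alpha+2)}{p+1}}=\Lambda r^{\frac{\alpha+2}{p+1}}\Bigl(1+O\bigl(r^{\frac{2p-\alpha}{p+1}}\bigr)\Bigr),$$ where $$\Lambda=\left(\frac{\lambda}{\frac{\alpha+2}{p+1}\left(\frac{\alpha+2}{p+1}+N-2\right)}\right)^{\frac1{p+1}},$$ $d_1$ depends on $F,p,\alpha,N$, and $d_2,d_3,\dots$ depend on $p,\alpha,N,\lambda$.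
   Context: A rupture solution near the origin is a function $u$ on a neighbourhood of the origin in $\mathbb{R}^N$ with $u(0)=0$ and $u>0$ away from the origin, satisfying the equation away from the origin. The $d_i$ are constants. The infinite sum is an asymptotic expansion of arbitrary order: for every $n\ge1$, $u(r)=\Lambda r^{\frac{\alpha+2}{p+1}}+\sum_{i=1}^{n}d_i r^{\frac{(2p-\alpha)i+(\alpha+2)}{p+1}}+O\bigl(r^{\frac{(2p-\alpha)(n+1)+(\alpha+2)}{p+1}}\bigr)$ as $r\to0^+$.
   Formalization: The claim that d_2, d_3, … depend on p, α, N, λ cannot exclude F: the equation makes d_2 a nonzero multiple of F². What is proved is that each d_i with i ≥ 2 is a function of p, α, N, λ and d_1, so F enters only through d_1. *)

(* Defs.v *)
From mathcomp Require Import all_boot all_order all_algebra.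
From mathcomp Require Import all_classical all_reals all_analysis.

Set Implicit Arguments.
Unset Strict Implicit.
Unset Printing Implicit Defensive.
Import Order.TTheory GRing.Theory Num.Theory.
Import numFieldNormedType.Exports.
Local Open Scope classical_set_scope.
Local Open Scope ring_scope.

(* The library norm `|x| on 'rV[R]_N is the sup norm; |x| in the equation is
   the Euclidean norm. *)
Definition enorm {R : realType} {N : nat} (x : 'rV[R]_N) : R :=
  Num.sqrt (\sum_(i < N) x 0 i ^+ 2).

Definition partial {R : realType} {N : nat} (i : 'I_N) (f : 'rV[R]_N -> R)
  : 'rV[R]_N -> R := fun x => 'D_(delta_mx 0 i) f x.

Definition laplacian {R : realType} {N : nat} (f : 'rV[R]_N -> R)
    (x : 'rV[R]_N) : R :=
  \sum_(i < N) partial i (partial i f) x.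

(* Pointwise condition: f is of class C^2 on an open set when this holds at
   each of its points. The library derivative 'D_v f x is total, hence the
   explicit derivability clauses. *)
Definition C2_at {R : realType} {N : nat} (f : 'rV[R]_N -> R)
    (x : 'rV[R]_N) : Prop :=
  {for x, continuous f} /\
  forall i : 'I_N,
    [/\ derivable f x (delta_mx 0 i),
        {for x, continuous (partial i f)} &
        forall j : 'I_N,
          derivable (partial i f) x (delta_mx 0 j) /\
          {for x, continuous (partial j (partial i f))}].

(* u is a total function, but only its values on some neighbourhood of 0 are
   constrained. *)
Definition rupture_solution {R : realType} {N : nat} (lambda p F alpha : R)
    (u : 'rV[R]_N -> R) : Prop :=
  u 0 = 0 /\
  \forall x \near (0 : 'rV[R]_N), x != 0 ->
    [/\ C2_at u x, 0 < u x &
        laplacian u x = lambda * (enorm x `^ alpha) / (u x `^ p) + F].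

Definition radial_near0 {R : realType} {N : nat} (u : 'rV[R]_N -> R)
    (v : R -> R) : Prop :=
  \forall x \near (0 : 'rV[R]_N), u x = v (enorm x).

Definition Lambda {R : realType} (N : nat) (lambda p alpha : R) : R :=
  let beta := (alpha + 2) / (p + 1) in
  (lambda / (beta * (beta + N%:R - 2))) `^ (1 / (p + 1)).

Definition expo {R : realType} (p alpha : R) (i : nat) : R :=
  ((2 * p - alpha) * i%:R + (alpha + 2)) / (p + 1).

Definition partial_expansion {R : realType} (N : nat) (lambda p alpha : R)
    (d : nat -> R) (n : nat) : R -> R := fun r =>
  Lambda N lambda p alpha * r `^ ((alpha + 2) / (p + 1)) +
  \sum_(1 <= i < n.+1) d i * r `^ expo p alpha i.

Definition has_expansion {R : realType} (N : nat) (lambda p alpha : R)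
    (d : nat -> R) (v : R -> R) : Prop :=
  forall n : nat, (1 <= n)%N ->
    (fun r => v r - partial_expansion N lambda p alpha d n r : R^o)
      =O_ ((0 : R)^'+) (fun r => r `^ expo p alpha n.+1 : R^o).

Definition has_leading_order {R : realType} (N : nat) (lambda p alpha : R)
    (v : R -> R) : Prop :=
  exists2 e : R -> R^o,
    e =O_ ((0 : R)^'+) (fun r => r `^ ((2 * p - alpha) / (p + 1)) : R^o) &
    \forall r \near (0 : R)^'+,
      v r = Lambda N lambda p alpha * r `^ ((alpha + 2) / (p + 1)) * (1 + e r).

(* D1 and D are functions of the parameters alone, fixed before the parameters
   are chosen. The coefficients of index i >= 2 cannot be independent of F (the
   equation forces d_2 to be a nonzero multiple of d_1 ^+ 2, and d_1 to be a
   nonzero multiple of F): F enters them through d_1 only. *)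
Definition coef_dependence {R : realType} (D1 : R -> R -> R -> nat -> R)
    (D : nat -> R -> R -> nat -> R -> R -> R)
    (N : nat) (lambda p F alpha : R) (d : nat -> R) : Prop :=
  d 1%N = D1 F p alpha N /\
  forall i : nat, (2 <= i)%N -> d i = D i p alpha N lambda (d 1%N).

(* Main.v *)
Require Import Defs.
From mathcomp Require Import all_boot all_order all_algebra.
From mathcomp Require Import all_classical all_reals all_analysis.
From mathcomp Require Import ring lra.
Import Order.TTheory GRing.Theory Num.Theory.
Import numFieldNormedType.Exports.
Local Open Scope classical_set_scope.
Local Open Scope ring_scope.

Set Implicit Arguments.
Unset Strict Implicit.
Unset Printing Implicit Defensive.

(** The equation has an exact solution of the form
    [u = Lambda r^beta Y(r^sigma)] with [Y] analytic near 0 and [Y(0) = 1],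
    where [beta = (alpha + 2) / (p + 1)] and
    [sigma = (2 p - alpha) / (p + 1)]; the announced expansion is its Taylor
    series.

    The Laplacian sends [r^e] to [e (e + N - 2) r^(e - 2)]. With
    [e_n = beta + sigma n] and [q_n = e_n (e_n + N - 2)], and because
    [beta + sigma = 2] and [alpha - p beta = beta - 2], every term of the
    equation is [r^(beta - 2)] times a function of [s = r^sigma], and it reads
    [sum q_n y_n s^n = kap Y(s)^(-p) + (F / Lambda) s], where [kap = q_0]; the
    value of [Lambda] is the one that makes the constant terms agree. The
    coefficient of [s^n] in [Y^(-p)] is [- p y_n] plus a polynomial in
    [y_1, ..., y_(n-1)], so [y_n] enters with the factor [q_n + p kap > 0]: the
    recursion never degenerates and determines all the [y_n] from
    [y_1 = F / (Lambda (q_1 + p kap))]. In particular [d_1 = Lambda y_1] does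
    not involve [lambda], and [d_n = Lambda y_n] is a function of [d_1] and of
    [p], [alpha], [N], [lambda].

    To stay within products of power series, the series [Z] of [Y^(-p)] is
    built together with [Y], through [Y Z' + p Y' Z = 0], that is, through
    [(Z Y^p)' = 0] (lemmas [coef_ode], [coef_conv], [psum_powRN]). The
    quadratic growth of [q_n] gives a geometric bound on both sequences
    ([coef_bound]), hence a positive radius of convergence.

    In [R^N] the solution is handled as [G(|x|^2)], with
    [G(t) = Lambda t^(beta/2) Y(t^(sigma/2))]: the sum of squares is
    polynomial, so only the one-variable chain rule is needed, and the
    Laplacian is [4 t G'' + 2 N G'] ([laplacian_radial]). Functions of the form
    [t^b A(t^tau)] are stable under differentiation, with an explicit action on
    the coefficients of [A] ([is_derive_pprofile]), which turns the equation
    into the recursion ([profile_ode]). *)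

(** * Power series with a positive radius of convergence *)

Definition psum {R : realType} (a : nat -> R) (s : R) : R := limn (pseries a s).

(** By Cauchy's root estimate this says that the radius of convergence is at
    least [r]. In this form the property is stable under multiplication of the
    n-th coefficient by [n], without loss on [r]. *)
Definition radius_ge {R : realType} (r : R) (a : nat -> R) : Prop :=
  forall rho, 0 < rho -> rho < r ->
    exists C, forall k, `|a k| * rho ^+ k <= C.

Section PowerSeries.
Variables (R : realType) (r : R).
Implicit Types (a c : nat -> R) (s : R).

Lemma is_cvg_pseries_lt a rho C s :
  0 < rho -> (forall k, `|a k| * rho ^+ k <= C) -> `|s| < rho ->
  cvgn (pseries a s).
Proof.
move=> rho0 aC sr; apply: normed_cvg.
apply: (@series_le_cvg _ _ (geometric C (`|s| / rho))).
- by move=> k /=; exact: normr_ge0.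
- move=> k /=; rewrite mulr_ge0 ?exprn_ge0 ?divr_ge0 ?(ltW rho0) //.
  exact: le_trans (mulr_ge0 _ _) (aC 0%N).
- move=> k /=; rewrite normrM normrX expr_div_n.
  rewrite mulrA ler_pdivlMr ?exprn_gt0 // mulrAC.
  by rewrite ler_wpM2r ?exprn_ge0.
- apply: is_cvg_geometric_series.
  by rewrite ger0_norm ?divr_ge0 ?(ltW rho0) // ltr_pdivrMr // mul1r.
Qed.

Lemma radius_cvg a s : radius_ge r a -> `|s| < r -> cvgn (pseries a s).
Proof.
move=> ra sr; have [||C aC] := ra ((`|s| + r) / 2) _ _.
- by have := normr_ge0 s; lra.
- by lra.
have sr' : `|s| < (`|s| + r) / 2 by lra.
by apply: is_cvg_pseries_lt aC sr'; have := normr_ge0 s; lra.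
Qed.

Lemma radiusZ x a : radius_ge r a -> radius_ge r (fun k => x * a k).
Proof.
move=> ra rho r0 rr; have [C aC] := ra rho r0 rr; exists (`|x| * C) => k.
by rewrite normrM -mulrA ler_wpM2l.
Qed.

Lemma radiusD a c : radius_ge r a -> radius_ge r c ->
  radius_ge r (fun k => a k + c k).
Proof.
move=> ra rc rho r0 rr; have [C aC] := ra rho r0 rr.
have [D cD] := rc rho r0 rr; exists (C + D) => k.
apply: le_trans (lerD (aC k) (cD k)); rewrite -mulrDl.
by rewrite ler_wpM2r ?exprn_ge0 ?(ltW r0) // ler_normD.
Qed.

Lemma radius_shift m a : radius_ge r a -> radius_ge r (fun k => a (k + m)%N).
Proof.
move=> ra rho r0 rr; have [C aC] := ra rho r0 rr; exists (C / rho ^+ m) => k.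
by rewrite ler_pdivlMr ?exprn_gt0 // -mulrA -exprD.
Qed.

(** Bernoulli's inequality [1 + k q <= (1 + q)^k] shows that passing to a
    slightly larger radius absorbs the factor [k]. *)
Lemma radius_mulk a : radius_ge r a -> radius_ge r (fun k => k%:R * a k).
Proof.
move=> ra rho r0 rr; set rh := (rho + r) / 2.
have [||C aC] := ra rh _ _; [by rewrite /rh; lra..|].
pose q := rh / rho - 1.
have q0 : 0 < q by rewrite /q subr_gt0 ltr_pdivlMr // mul1r /rh; lra.
have bern k : k%:R * q * rho ^+ k <= rh ^+ k.
  have -> : rh = (1 + q) * rho by rewrite /q addrC subrK divfK // gt_eqF.
  rewrite exprMn ler_wpM2r ?exprn_ge0 ?(ltW r0) //.
  elim: k => [|k IH]; first by rewrite expr0 !mul0r ler01.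
  rewrite exprS -[k.+1]addn1 natrD.
  have k0 : (0 : R) <= k%:R by [].
  have p1 : 1 <= (1 + q) ^+ k by rewrite exprn_ege1 // lerDl ltW.
  by nra.
exists (C / q) => k; rewrite ler_pdivlMr // normrM normr_nat.
apply: le_trans (aC k).
have -> : k%:R * `|a k| * rho ^+ k * q = `|a k| * (k%:R * q * rho ^+ k) by ring.
by rewrite ler_wpM2l.
Qed.

Lemma radius_diffs a : radius_ge r a -> radius_ge r (pseries_diffs a).
Proof.
move=> /radius_mulk/(radius_shift 1) ra rho r0 rr.
have [C aC] := ra rho r0 rr; exists C => k.
by rewrite /pseries_diffs -addn1; exact: aC.
Qed.

Lemma psumZ x a s : radius_ge r a -> `|s| < r ->
  psum (fun k => x * a k) s = x * psum a s.
Proof.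
move=> ra sr; have ca := radius_cvg ra sr.
apply/cvg_lim => //.
rewrite (_ : pseries _ s = (fun n => x * pseries a s n)); last first.
  apply/funext => n; rewrite /pseries /series /= mulr_sumr.
  by apply: eq_bigr => i _; rewrite -mulrA.
by apply: cvgM => //; exact: cvg_cst.
Qed.

Lemma psumD a c s : radius_ge r a -> radius_ge r c -> `|s| < r ->
  psum (fun k => a k + c k) s = psum a s + psum c s.
Proof.
move=> ra rc sr; have ca := radius_cvg ra sr; have cc := radius_cvg rc sr.
apply/cvg_lim => //.
rewrite (_ : pseries _ s = (fun n => pseries a s n + pseries c s n)).
  exact: cvgD.
apply/funext => n; rewrite /pseries /series /= -big_split /=.
by apply: eq_bigr => i _; rewrite mulrDl.
Qed.

Lemma psum_recl a s : radius_ge r a -> `|s| < r ->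
  psum a s = a 0%N + s * psum (fun k => a k.+1) s.
Proof.
move=> ra sr; have ca := radius_cvg ra sr.
have cb : cvgn (pseries (fun k => a k.+1) s).
  apply: radius_cvg sr; under eq_fun do rewrite -addn1; exact: radius_shift.
have : pseries a s n.+1 @[n --> \oo] --> psum a s by rewrite cvg_shiftS.
move/cvg_lim => <- //.
apply/cvg_lim => //.
have -> : (fun n => pseries a s n.+1) =
    (fun n => a 0%N + s * pseries (fun k => a k.+1) s n).
  apply/funext => n; rewrite /pseries /series /= big_nat_recl //= expr0 mulr1.
  congr (_ + _); rewrite mulr_sumr; apply: eq_bigr => i _.
  by rewrite exprS; ring.
by apply: cvgD; [exact: cvg_cst|apply: cvgM => //; exact: cvg_cst].
Qed.

Lemma psum_split m a s : radius_ge r a -> `|s| < r ->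
  psum a s = \sum_(k < m) a k * s ^+ k + s ^+ m * psum (fun k => a (k + m)%N) s.
Proof.
move=> ra sr; elim: m => [|m IH].
  by rewrite big_ord0 add0r expr0 mul1r; under eq_fun do rewrite addn0.
rewrite IH big_ord_recr /= -addrA; congr (_ + _).
rewrite (psum_recl (radius_shift m _)) // add0n mulrDr exprSr mulrC.
by rewrite mulrA; under eq_fun do rewrite addSnnS.
Qed.

(** Multiplying the k-th coefficient by [k] is the Euler operator [s d/ds].
    Unlike the shift in [pseries_diffs], it keeps the degrees in place, so
    identities between coefficients stay free of index shifts. *)
Lemma psum_mulk a s : radius_ge r a -> `|s| < r ->
  psum (fun k => k%:R * a k) s = s * psum (pseries_diffs a) s.
Proof. by move=> ra sr; rewrite (psum_recl (radius_mulk ra)) // mul0r add0r. Qed.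

Lemma is_derive_psum a s : radius_ge r a -> `|s| < r ->
  is_derive s 1 (psum a) (psum (pseries_diffs a) s).
Proof.
move=> ra sr; pose K := (`|s| + r) / 2.
have K0 : 0 <= K by rewrite /K; have := normr_ge0 s; lra.
have Kr : `|K| < r by rewrite ger0_norm // /K; lra.
apply: (@pseries_snd_diffs _ a K); try exact: radius_cvg Kr.
- by apply: radius_cvg Kr; exact: radius_diffs.
- by apply: radius_cvg Kr; do 2!apply: radius_diffs.
- by rewrite (ger0_norm K0) /K; lra.
Qed.

End PowerSeries.

Section CauchyProduct.
Variables (R : realType) (r : R).
Implicit Types (a c : nat -> R) (s : R).

Lemma psum_bound a rho C s :
  0 < rho -> (forall k, `|a k| * rho ^+ k <= C) -> `|s| <= rho / 2 ->
  `|psum a s| <= 2 * C.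
Proof.
move=> rho0 aC srho.
have C0 : 0 <= C by apply: le_trans (aC 0%N); rewrite expr0 mulr1.
have ca : cvgn (pseries a s).
  by apply: is_cvg_pseries_lt aC _ => //; lra.
rewrite /psum -lim_norm //; apply: limr_le; first exact: is_cvg_norm.
near=> n; rewrite /pseries /series /= big_mkord.
suff : `|\sum_(i < n) a i * s ^+ i| <= 2 * C * (1 - 2^-1 ^+ n).
  move/le_trans; apply; apply: ler_piMr; first by rewrite mulr_ge0.
  by rewrite gerBl exprn_ge0 // invr_ge0.
elim: (n) => [|m IH]; first by rewrite big_ord0 normr0 expr0 subrr mulr0.
rewrite big_ord_recr /=; apply: le_trans (ler_normD _ _) _.
have : `|a m * s ^+ m| <= C * 2^-1 ^+ m.
  rewrite normrM normrX; apply: le_trans (_ : `|a m| * (rho / 2) ^+ m <= _).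
    by rewrite ler_wpM2l // lerXn2r // nnegrE // ltW // divr_gt0.
  by rewrite exprMn mulrA ler_wpM2r // exprn_ge0 // invr_ge0.
have : 0 <= 2^-1 ^+ m :> R by rewrite exprn_ge0 // invr_ge0.
rewrite exprS; set h := _ ^+ m in IH *; move=> h0 h1.
by apply: le_trans (lerD IH h1) _; lra.
Unshelve. all: by end_near. Qed.

(** The sum of the series of shifted coefficients is bounded near 0, and the
    remainder of order [m] is [s^m] times it. *)
Lemma psum_tail a m : 0 < r -> radius_ge r a ->
  exists2 D, 0 < D & forall s, `|s| <= r / 4 ->
    `|psum a s - \sum_(k < m) a k * s ^+ k| <= D * `|s| ^+ m.
Proof.
move=> r0 ra; have [||C aC] := radius_shift m ra (rho := r / 2); [lra..|].
have C0 : 0 <= C by apply: le_trans (aC 0%N); rewrite expr0 mulr1.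
exists (2 * C + 1) => [|s sr]; first lra.
rewrite (psum_split m ra); last by lra.
rewrite addrAC subrr add0r normrM normrX mulrC ler_wpM2r ?exprn_ge0 //.
have h : `|psum (fun k => a (k + m)%N) s| <= 2 * C.
  by apply: (psum_bound _ aC); lra.
lra.
Qed.

Definition cauchy_prod a c n := \sum_(i < n.+1) a i * c (n - i)%N.

Lemma cvg_mulnX (x : R) : 0 <= x -> x < 1 -> n%:R * x ^+ n @[n --> \oo] --> 0.
Proof.
move=> x0 x1; have r1 : radius_ge 1 (fun k => k%:R * 1 : R).
  apply: radius_mulk => rho rho0 rho1; exists 1 => k.
  by rewrite normr1 mul1r exprn_ile1 // ltW.
have := radius_cvg r1 (s := x); rewrite ger0_norm // => /(_ x1).
by move=> /cvg_series_cvg_0; under eq_fun do rewrite mulr1.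
Qed.

(** The partial sums of a Cauchy product are sums over the triangle
    [i + j < n], here read row by row. *)
Lemma pseries_cauchy_prod a c s n : pseries (cauchy_prod a c) s n =
  \sum_(i < n) (a i * s ^+ i) * \sum_(j < n - i) c j * s ^+ j.
Proof.
rewrite /pseries /series /= big_mkord; elim: n => [|n IH].
  by rewrite !big_ord0.
rewrite big_ord_recr /= IH [RHS]big_ord_recr /= subSnn big_ord1 /cauchy_prod.
rewrite big_ord_recr /= subnn mulrDl addrA; congr (_ + _); last first.
  by rewrite expr0; ring.
rewrite mulr_suml -big_split /=; apply: eq_bigr => i _.
rewrite subSn ?(ltnW (ltn_ord i)) // big_ord_recr /= mulrDr; congr (_ + _).
have -> : s ^+ n = s ^+ i * s ^+ (n - i) by rewrite -exprD subnKC // ltnW.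
by ring.
Qed.

(** The square [i, j < n] minus the triangle [i + j < n] only contains terms of
    total degree at least [n]: with [x = |s| / rho < 1] its row sums are
    [O(x^n)], so its sum is [O(n x^n)]. *)
Lemma cvg_cauchy_prod a c s : radius_ge r a -> radius_ge r c -> `|s| < r ->
  pseries (cauchy_prod a c) s @ \oo --> psum a s * psum c s.
Proof.
move=> ra rc sr; pose rho := (`|s| + r) / 2.
have s0 := normr_ge0 s.
have rho0 : 0 < rho by rewrite /rho; lra.
have rhor : rho < r by rewrite /rho; lra.
have [A aA] := ra rho rho0 rhor; have [B cB] := rc rho rho0 rhor.
have A0 : 0 <= A by apply: le_trans (aA 0%N); rewrite expr0 mulr1.
have B0 : 0 <= B by apply: le_trans (cB 0%N); rewrite expr0 mulr1.
pose x := `|s| / rho.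
have x0 : 0 <= x by rewrite divr_ge0 // ltW.
have x1 : x < 1 by rewrite ltr_pdivrMr // mul1r /rho; lra.
have geo (d : nat -> R) D k : `|d k| * rho ^+ k <= D ->
    `|d k * s ^+ k| <= D * x ^+ k.
  move=> dD; rewrite normrM normrX expr_div_n mulrA ler_pdivlMr ?exprn_gt0 //.
  by rewrite mulrAC ler_wpM2r ?exprn_ge0.
have xi i j : (i <= j)%N -> \sum_(i <= k < j) x ^+ k <= x ^+ i / (1 - x).
  move=> ij; rewrite ler_pdivlMr ?subr_gt0 //.
  suff -> : (\sum_(i <= k < j) x ^+ k) * (1 - x) = x ^+ i - x ^+ j.
    by rewrite gerBl exprn_ge0.
  rewrite mulr_suml (@telescope_sumr_eq _ _ _ (fun k => - x ^+ k)) //; first by ring.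
  by move=> k _; rewrite exprS; ring.
have ca := radius_cvg ra sr; have cc := radius_cvg rc sr.
have prod : pseries a s n * pseries c s n @[n --> \oo] --> psum a s * psum c s.
  exact: cvgM.
have err : pseries a s n * pseries c s n - pseries (cauchy_prod a c) s n
    @[n --> \oo] --> 0.
  apply/norm_cvg0P.
  have lim0 : A * B / (1 - x) * (n%:R * x ^+ n) @[n --> \oo] --> 0.
    rewrite -[X in _ --> X](mulr0 (A * B / (1 - x))).
    by apply: cvgM (cvg_mulnX x0 x1); exact: cvg_cst.
  apply: (squeeze_cvgr _ (cvg_cst 0) lim0).
  near=> n; rewrite normr_ge0 /=.
  rewrite pseries_cauchy_prod /pseries /series /= !big_mkord mulr_suml -sumrB.
  apply: le_trans (ler_norm_sum _ _ _) _.
  apply: (@le_trans _ _ (\sum_(i < n) A * B / (1 - x) * x ^+ n)); last first.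
    by rewrite sumr_const card_ord -mulr_natl; lra.
  apply: ler_sum => i _; rewrite -mulrBr.
  rewrite -(big_mkord predT (fun j => c j * s ^+ j)).
  rewrite -(big_mkord predT (fun j => c j * s ^+ j)).
  rewrite (big_cat_nat (leq0n (n - i)%N) (leq_subr i n)) /= addrAC subrr add0r.
  rewrite normrM.
  have -> : A * B / (1 - x) * x ^+ n = (A * x ^+ i) * (B * (x ^+ (n - i) / (1 - x))).
    have -> : x ^+ n = x ^+ i * x ^+ (n - i) by rewrite -exprD subnKC // ltnW.
    by ring.
  apply: ler_pM => //; first exact: geo.
  apply: le_trans (ler_norm_sum _ _ _) _.
  apply: le_trans (_ : B * \sum_(n - i <= k < n) x ^+ k <= _).
    by rewrite mulr_sumr; apply: ler_sum => k _; exact: geo.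
  by rewrite ler_wpM2l // xi // leq_subr.
rewrite -[X in _ --> X]subr0.
rewrite (_ : pseries (cauchy_prod a c) s = fun n => pseries a s n * pseries c s n -
  (pseries a s n * pseries c s n - pseries (cauchy_prod a c) s n)).
  exact: cvgB.
by apply/funext => n; ring.
Unshelve. all: by end_near. Qed.

End CauchyProduct.

Lemma psum0 (R : realType) (r : R) (a : nat -> R) :
  0 < r -> radius_ge r a -> psum a 0 = a 0%N.
Proof. by move=> r0 ra; rewrite (psum_recl ra) ?normr0 // mul0r addr0. Qed.

Lemma radius_X (R : realType) (r c : R) :
  radius_ge r (fun k => (k == 1%N)%:R * c).
Proof.
move=> rho rho0 _; exists (`|c| * rho) => -[|[|k]] /=.
- by rewrite mul0r normr0 mul0r mulr_ge0 // ltW.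
- by rewrite mul1r expr1.
- by rewrite mul0r normr0 mul0r mulr_ge0 // ltW.
Qed.

Lemma psum_X (R : realType) (c s : R) :
  psum (fun k => (k == 1%N)%:R * c) s = c * s.
Proof.
have sr : `|s| < `|s| + 1 by rewrite ltrDl.
have r0 := @radius_X R (`|s| + 1) c.
rewrite (psum_split 2 r0 sr) !big_ord_recr big_ord0 /=.
rewrite (_ : (fun k => ((k + 2)%N == 1%N)%:R * c) = fun k => 0 * ((k == 1%N)%:R * c)).
  by rewrite (psumZ 0 r0 sr); ring.
by apply/funext => k; rewrite addn2 !mul0r.
Qed.

(** * The series of a negative power *)

(** The hypothesis on the Cauchy products says that [s (Y Z' + p Y' Z) = 0],
    that is, [(Z Y^p)' = 0] where [Y > 0]; and [Z Y^p = 1] at 0. This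
    characterizes the series of [Y^(-p)] by a relation that is bilinear in the
    coefficients. *)
Lemma psum_powRN (R : realType) (p r : R) (y z : nat -> R) :
  0 < r -> radius_ge r y -> radius_ge r z -> y 0%N = 1 -> z 0%N = 1 ->
  (forall n, cauchy_prod y (fun k => k%:R * z k) n
             + p * cauchy_prod (fun k => k%:R * y k) z n = 0) ->
  exists d, [/\ 0 < d, d <= r &
    forall s, 0 <= s -> s < d ->
      0 < psum y s /\ psum z s = psum y s `^ (- p)].
Proof.
move=> r0 ry rz y0 z0 yz.
have [D D0 tail] := psum_tail 1 r0 ry.
(* On this disc [|Y(s) - 1| <= D |s| < 1 / 2], so that [Y] is positive. *)
pose d := Num.min (r / 4) (2 * D)^-1.
have d0 : 0 < d by rewrite lt_min divr_gt0 //= invr_gt0 mulr_gt0.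
have dr : d < r.
  by apply: (@le_lt_trans _ _ (r / 4)); [rewrite ge_min lexx|lra].
have ypos s : `|s| < d -> 0 < psum y s.
  rewrite lt_min => /andP[s1 s2]; have := tail s (ltW s1).
  rewrite big_ord1 y0 expr0 mul1r expr1 => h.
  have : D * `|s| < 2^-1.
    by rewrite -ltr_pdivlMl // -invfM mulrC.
  by move: h; rewrite ler_norml => /andP[]; lra.
have ode s : 0 < s -> s < d ->
    psum y s * psum (pseries_diffs z) s + p * (psum (pseries_diffs y) s * psum z s) = 0.
  move=> s0 sd; have sr : `|s| < r by rewrite gtr0_norm //; exact: lt_trans dr.
  have h1 := cvg_cauchy_prod ry (radius_mulk rz) sr.
  have h2 := cvg_cauchy_prod (radius_mulk ry) rz sr.
  pose f n := pseries (cauchy_prod y (fun k => k%:R * z k)) s n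
      + p * pseries (cauchy_prod (fun k => k%:R * y k) z) s n.
  have h : f @ \oo --> psum y s * psum (fun k => k%:R * z k) s +
      p * (psum (fun k => k%:R * y k) s * psum z s).
    by apply: cvgD => //; apply: cvgM => //; exact: cvg_cst.
  have f0 : f = cst 0.
    apply/funext => n; rewrite /f /pseries /series /=.
    rewrite mulr_sumr -big_split big1 //= => k _.
    by rewrite mulrA -mulrDl yz mul0r.
  have := cvg_lim (@Rhausdorff R) h; rewrite f0 lim_cst //.
  rewrite (psum_mulk rz sr) (psum_mulk ry sr) => e.
  by apply: (mulfI (lt0r_neq0 s0)); rewrite mulr0 [RHS]e; ring.
exists d; split => // [|s s0 sd]; first exact: ltW.
have sd' : `|s| < d by rewrite ger0_norm.
split; first exact: ypos.
pose h t := psum z t * psum y t `^ p.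
have dh (t : R) : `|t| < d -> is_derive t 1 h
   (psum z t * (p * psum y t `^ (p - 1) * psum (pseries_diffs y) t) +
    psum y t `^ p * psum (pseries_diffs z) t).
  move=> td; have tr := lt_trans td dr.
  have dz := is_derive_psum rz tr; have dy := is_derive_psum ry tr.
  have dp := is_derive1_powR p (ypos _ td).
  exact: is_deriveM dz (is_derive1_comp dp dy).
have h0 : h 0 = 1.
  by rewrite /h (psum0 r0 rz) (psum0 r0 ry) z0 y0 powR1 mul1r.
have hs : h s - h 0 = 0.
  move: s0 sd {sd'}; rewrite le_eqVlt => /predU1P[<-|s0] sd; first by rewrite subrr.
  have dh' (t : R) : t \in `]0, s[ -> is_derive t 1 h 0.
    rewrite in_itv /= => /andP[t0 ts]; have td := lt_trans ts sd.
    have td' : `|t| < d by rewrite gtr0_norm.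
    apply: is_derive_eq (dh t td') _.
    have yt := ypos _ td'.
    have -> : psum y t `^ p = psum y t * psum y t `^ (p - 1).
      rewrite -[X in X * _]powRr1 ?(ltW yt) // -powRD; first by congr (_ `^ _); ring.
      by rewrite (gt_eqF yt) implybT.
    transitivity (psum y t `^ (p - 1) *
      (psum y t * psum (pseries_diffs z) t + p * (psum (pseries_diffs y) t * psum z t))).
      by ring.
    by rewrite ode // mulr0.
  have [|c _ ->] := MVT s0 dh'; last by rewrite mul0r.
  apply: derivable_within_continuous => t; rewrite in_itv /= => /andP[t0 ts].
  by apply: ex_derive; apply: dh; rewrite ger0_norm // (le_lt_trans ts).
move/eqP: hs; rewrite h0 subr_eq0 => /eqP hs.
have yp : psum y s `^ p != 0 by rewrite gt_eqF // powR_gt0 // ypos.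
by apply: (mulIf yp); rewrite -/(h s) hs powRN mulVf.
Qed.

(** * The recursion for the coefficients and its growth *)

Section Recursion.
Variables (R : realType) (p kap y1 : R) (q : nat -> R).

(** The part of the n-th coefficient of [Y^(-p)] that involves only
    coefficients of index strictly between 0 and [n]: by the relation
    [Y (s Z') + p (s Y') Z = 0] it equals [z_n + p y_n]. *)
Definition cross_term (h : nat -> R * R) (n : nat) : R :=
  - (\sum_(1 <= k < n) (p * k%:R + (n - k)%:R) * (h k).1 * (h (n - k)%N).2)
    / n%:R.

(** Equating the coefficients of [s^n] gives [(q n + p kap) y_n = kap t] for
    [n >= 2], with [t] the cross term. The coefficient [y1] of index 1 is a
    parameter, since it is the one through which [F] enters. *)
Definition coef_step (h : nat -> R * R) (n : nat) : R * R :=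
  if n == 0%N then (1, 1) else
  let t := cross_term h n in
  let y := kap * t / (q n + p * kap) + (n == 1%N)%:R * y1 in (y, t - p * y).

(** Course-of-values recursion: the n-th approximation is correct at all
    indices below [n], and arbitrary elsewhere. *)
Fixpoint coef_approx (n : nat) : nat -> R * R :=
  if n is m.+1 then coef_step (coef_approx m) else fun=> (0, 0).

Definition coef (n : nat) : R * R := coef_approx n.+1 n.

Definition ycoef n := (coef n).1.
Definition zcoef n := (coef n).2.

Lemma eq_cross_term g h n : (forall k, (k < n)%N -> g k = h k) ->
  cross_term g n = cross_term h n.
Proof.
move=> gh; rewrite /cross_term; congr (- _ / _); apply: eq_big_nat => k /andP[k1 kn].
by rewrite !gh // -subn_gt0 subKn // ltnW.
Qed.

Lemma eq_coef_step g h n : (forall k, (k < n)%N -> g k = h k) ->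
  coef_step g n = coef_step h n.
Proof. by move=> gh; rewrite /coef_step (eq_cross_term gh). Qed.

Lemma coefE n : coef n = coef_step coef n.
Proof.
suff coef_approxE m k : (k < m)%N -> coef_approx m k = coef k.
  by rewrite /coef /=; apply: eq_coef_step => k; exact: coef_approxE.
elim/ltn_ind: k m => k IH [//|m] km; rewrite /coef /=; apply: eq_coef_step => j jk.
by rewrite !IH // (leq_trans jk).
Qed.

Lemma ycoef0 : ycoef 0 = 1. Proof. by rewrite /ycoef coefE. Qed.
Lemma zcoef0 : zcoef 0 = 1. Proof. by rewrite /zcoef coefE. Qed.

Lemma ycoefS n : ycoef n.+1 = kap * cross_term coef n.+1 / (q n.+1 + p * kap)
  + (n == 0%N)%:R * y1.
Proof. by rewrite /ycoef coefE. Qed.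

Lemma zcoefS n : zcoef n.+1 = cross_term coef n.+1 - p * ycoef n.+1.
Proof. by rewrite /zcoef /ycoef coefE. Qed.

Lemma cross_term1 : cross_term coef 1 = 0.
Proof. by rewrite /cross_term big_geq // oppr0 mul0r. Qed.

Lemma ycoef1 : ycoef 1 = y1.
Proof. by rewrite ycoefS cross_term1 mulr0 !mul0r add0r mul1r. Qed.

Hypothesis p0 : 0 < p.
Hypothesis kap0 : 0 < kap.
Hypothesis q_gt0 : forall n, 0 < q n.

Lemma coef_ode n : q 0 = kap ->
  q n * ycoef n = kap * zcoef n + (n == 1%N)%:R * ((q 1 + p * kap) * y1).
Proof.
move=> q0; case: n => [|n]; first by rewrite ycoef0 zcoef0 q0 mul0r addr0.
have den m : q m + p * kap != 0.
  by rewrite gt_eqF // addr_gt0 // mulr_gt0.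
rewrite zcoefS; have := ycoefS n.
case: n => [|n] /=; last first.
  rewrite !mul0r !addr0 => e.
  have : (q n.+2 + p * kap) * ycoef n.+2 = kap * cross_term coef n.+2.
    by rewrite e mulrC divfK.
  lra.
by rewrite ycoef1 cross_term1 => _; ring.
Qed.

(** The terms [k = 0] and [k = n] of the two products combine to
    [n (z_n + p y_n)], and the others to [- n] times the cross term. *)
Lemma coef_conv n :
  cauchy_prod ycoef (fun k => k%:R * zcoef k) n
  + p * cauchy_prod (fun k => k%:R * ycoef k) zcoef n = 0.
Proof.
case: n => [|n].
  by rewrite /cauchy_prod !big_ord1 subnn !mul0r mulr0 mulr0 addr0.
rewrite /cauchy_prod mulr_sumr -big_split /=.
rewrite -(big_mkord predT (fun k => ycoef k * ((n.+1 - k)%:R * zcoef (n.+1 - k))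
  + p * (k%:R * ycoef k * zcoef (n.+1 - k)))).
rewrite big_ltn // big_nat_recr //= subnn subn0 ycoef0 zcoef0 !mul0r.
have -> : \sum_(1 <= k < n.+1) (ycoef k * ((n.+1 - k)%:R * zcoef (n.+1 - k))
    + p * (k%:R * ycoef k * zcoef (n.+1 - k))) = - n.+1%:R * cross_term coef n.+1.
  rewrite /cross_term mulrC mulNr mulrNN divfK ?pnatr_eq0 //.
  by apply: eq_bigr => k _; rewrite /ycoef /zcoef; ring.
by rewrite zcoefS; ring.
Qed.

Lemma sum_invM n : \sum_(1 <= k < n) (k%:R * k.+1%:R)^-1 <= 1 :> R.
Proof.
case: n => [|n]; first by rewrite big_geq.
rewrite (@telescope_sumr_eq _ _ _ (fun k => - k%:R^-1)) //.
  by rewrite opprK invr1 gerDr oppr_le0.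
case=> [//|k] _; have k0 : 0 <= k%:R :> R by [].
by rewrite -!natr1; field; rewrite !gt_eqF //; lra.
Qed.

(** In the cross term the weights [(p k + n - k) / n] are at most [p + 1] and
    the sum of the [1 / (k (k + 1))] is at most 1, so the cross term is at most
    [(p + 1) A B M^n]. Dividing by [q n >= c n (n + 1)] restores the bound on
    [y_n] as soon as [kap (p + 1) B <= c], and the bound on [z_n] as soon as
    [A (p + (p + 1) B) <= B]. The constants [B], then [A], are chosen for
    equality, and [M] is chosen last to cover the index 1. *)
Lemma coef_bound c : 0 < c -> (forall n, c * (n%:R * n.+1%:R) <= q n) ->
  exists A B M : R, [/\ 0 < A, 0 < B, 0 < M &
   forall n, (0 < n)%N -> `|ycoef n| <= A * M ^+ n / (n%:R * n.+1%:R) /\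
             `|zcoef n| <= B * M ^+ n].
Proof.
move=> c0 cq; pose P := p + 1; pose B := c / (kap * P).
have P0 : 0 < P by move: p0; rewrite /P; lra.
have B0 : 0 < B by rewrite divr_gt0 // mulr_gt0.
pose A := B / (p + P * B).
have PB0 : 0 < P * B by rewrite mulr_gt0.
have A0 : 0 < A by rewrite divr_gt0 // addr_gt0.
have kapPB : kap * (P * B) = c by rewrite /B; field; rewrite !gt_eqF.
have AB : A * (p + P * B) = B by rewrite divfK // gt_eqF // addr_gt0.
(* At index 1 the bound is [|y1| <= A M / 2]. *)
pose M := 2 * `|y1| / A + 1.
have M0 : 0 < M.
  apply: ltr_wpDl => //; apply: divr_ge0; last exact: ltW.
  by rewrite mulr_ge0.
have AM : 2 * `|y1| <= A * M.
  by rewrite /M mulrDr mulrCA divff ?gt_eqF // !mulr1 lerDl ltW.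
have PE : P = p + 1 by [].
clearbody M A B P.
exists A, B, M; split => //; elim/ltn_ind => n IH n0.
have Mn m : 0 < M ^+ m by rewrite exprn_gt0.
have den_gt0 m : (0 < m)%N -> 0 < m%:R * m.+1%:R :> R.
  by move=> m0; rewrite mulr_gt0 ?ltr0n.
have crossB : `|cross_term coef n| <= P * (A * B) * M ^+ n.
  rewrite /cross_term normrM normrN normfV normr_nat ler_pdivrMr ?ltr0n //.
  apply: le_trans (ler_norm_sum _ _ _) _.
  apply: (@le_trans _ _ (\sum_(1 <= k < n)
      P * (A * B) * M ^+ n * n%:R * (k%:R * k.+1%:R)^-1)); last first.
    rewrite -mulr_sumr; apply: ler_piMr (sum_invM n).
    by do !apply: mulr_ge0 => //; exact: ltW.
  apply: ler_sum_nat => k /andP[k1 kn].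
  have [yk _] := IH k kn k1.
  have [||_ zk] := IH (n - k)%N; [by rewrite ltn_subrL k1|by rewrite subn_gt0|].
  rewrite !normrM -!/(ycoef _) -!/(zcoef _).
  have w : `|p * k%:R + (n - k)%:R| <= P * n%:R.
    rewrite ger0_norm ?addr_ge0 ?mulr_ge0 ?ler0n ?(ltW p0) //.
    have kn' : (k%:R : R) <= n%:R by rewrite ler_nat ltnW.
    have p0' := p0; by rewrite natrB ?(ltnW kn) // PE; have := ler0n R k; nra.
  have -> : M ^+ n = M ^+ k * M ^+ (n - k) by rewrite -exprD subnKC // ltnW.
  have -> : P * (A * B) * (M ^+ k * M ^+ (n - k)) * n%:R * (k%:R * k.+1%:R)^-1 =
     P * n%:R * (A * M ^+ k / (k%:R * k.+1%:R)) * (B * M ^+ (n - k)) by ring.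
  by apply: ler_pM => //; exact: ler_pM.
case: n n0 IH crossB => // n _ IH crossB; set T := cross_term coef n.+1 in crossB.
set w := (n.+1%:R * n.+2%:R).
have w1 : 1 <= w by rewrite /w -natrM ler1n.
case: (posnP n) => [n0|npos].
  rewrite /w zcoefS n0 ycoef1 cross_term1 sub0r normrN normrM (gtr0_norm p0) expr1.
  have := normr_ge0 y1; have -> : 1 * 2 = 2 :> R by rewrite mul1r.
  move=> y0; split; first lra.
  by have p0' := p0; rewrite -AB; nra.
have yB : `|ycoef n.+1| <= A * M ^+ n.+1 / w.
  rewrite ycoefS (gtn_eqF npos) mul0r addr0.
  have qw : c * w <= q n.+1 + p * kap.
    by apply: le_trans (cq _) _; rewrite lerDl mulr_ge0 // ltW.
  have cw : 0 < c * w by rewrite mulr_gt0 //; lra.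
  rewrite normrM normfV normrM (gtr0_norm kap0) (gtr0_norm (lt_le_trans cw qw)).
  rewrite ler_pdivrMr ?(lt_le_trans cw) //.
  apply: (@le_trans _ _ (A * M ^+ n.+1 / w * (c * w))); last first.
    rewrite ler_wpM2l // divr_ge0 ?mulr_ge0 ?(ltW A0) ?(ltW (Mn _)) //; lra.
  apply: (@le_trans _ _ (kap * (P * (A * B) * M ^+ n.+1))).
    by rewrite ler_wpM2l // ltW.
  rewrite -kapPB le_eqVlt; apply/orP; left; apply/eqP; field.
  by rewrite gt_eqF //; lra.
split=> //; rewrite zcoefS; apply: le_trans (ler_normB _ _) _.
rewrite (normrM p) (gtr0_norm p0) -AB.
have : A * M ^+ n.+1 / w <= A * M ^+ n.+1.
  rewrite ler_piMr ?mulr_ge0 ?(ltW A0) ?(ltW (Mn _)) // invf_le1 //; lra.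
move=> /(le_trans yB) yB'.
have : p * `|ycoef n.+1| <= p * (A * M ^+ n.+1) by rewrite ler_wpM2l // ltW.
by move=> h; apply: le_trans (lerD crossB h) _; lra.
Qed.

Lemma coef_radius c : 0 < c -> (forall n, c * (n%:R * n.+1%:R) <= q n) ->
  exists r, [/\ 0 < r, radius_ge r ycoef & radius_ge r zcoef].
Proof.
move=> c0 cq; have [A [B [M [A0 B0 M0 bnd]]]] := coef_bound c0 cq.
have bound (a : nat -> R) D : 0 < D -> a 0%N = 1 ->
    (forall n, (0 < n)%N -> `|a n| <= D * M ^+ n) -> radius_ge M^-1 a.
  move=> D0 a0 aD rho rho0 rhoM; exists (D + 1) => -[|k].
    by rewrite a0 normr1 expr0 mul1r; lra.
  apply: (@le_trans _ _ (D * (M * rho) ^+ k.+1)).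
    by rewrite exprMn mulrA ler_wpM2r ?exprn_ge0 ?(ltW rho0) // aD.
  have : (M * rho) ^+ k.+1 <= 1.
    apply: exprn_ile1; first by rewrite mulr_ge0 // ltW.
    by rewrite mulrC -ler_pdivlMr // div1r ltW.
  by nra.
exists M^-1; rewrite invr_gt0; split => //.
  apply: (bound _ A A0 ycoef0) => n n0; have [h _] := bnd n n0.
  apply: le_trans h _; rewrite ler_piMr ?mulr_ge0 ?exprn_ge0 ?(ltW A0) ?(ltW M0)//.
  by rewrite invf_le1 ?mulr_gt0 ?ltr0n // -natrM ler1n muln_gt0 n0.
by apply: (bound _ B B0 zcoef0) => n n0; have [_] := bnd n n0.
Qed.

End Recursion.

(** * Differentiation of a power times a series in another power *)

Definition pprofile {R : realType} (tau b : R) (a : nat -> R) (t : R) : R :=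
  t `^ b * psum a (t `^ tau).

(** Termwise, the derivative of [t^(b + tau k)] is
    [(b + tau k) t^(b - 1 + tau k)]. *)
Lemma is_derive_pprofile (R : realType) (r tau b t : R) (a : nat -> R) :
  radius_ge r a -> 0 < t -> t `^ tau < r ->
  is_derive t 1 (pprofile tau b a)
    (pprofile tau (b - 1) (fun k => (b + tau * k%:R) * a k) t).
Proof.
move=> ra t0 tr; have sr : `|t `^ tau| < r by rewrite ger0_norm // powR_ge0.
have d1 := is_derive1_powR b t0.
have d2 : is_derive t 1 (fun x => psum a (x `^ tau)) _ :=
  @is_derive1_comp R (psum a) (fun x => x `^ tau) t _ _ (is_derive_psum ra sr)
    (is_derive1_powR tau t0).
apply: is_derive_eq (is_deriveM d1 d2) _.
rewrite /pprofile.
have -> : (fun k => (b + tau * k%:R) * a k) = (fun k => b * a k + tau * (k%:R * a k)).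
  by apply/funext => k; ring.
rewrite (@psumD _ r) //; [|exact: radiusZ|exact/radiusZ/radius_mulk].
rewrite !(@psumZ _ r) //; last exact: radius_mulk.
rewrite (psum_mulk ra sr).
have e x : t `^ x = t * t `^ (x - 1).
  rewrite -[X in X * _]powRr1 ?(ltW t0) // -powRD; first by congr (_ `^ _); ring.
  by rewrite (gt_eqF t0) implybT.
rewrite /= (e tau).
rewrite (e b) /GRing.scale /=.
by ring.
Qed.

(** * The Laplacian of a function of the sum of squares *)

(** A directional derivative is a one-variable derivative along a line, which
    gives access to the one-variable chain rule. *)
Lemma is_derive_line (R : realType) (V : normedModType R) (f : V -> R) x v d :
  is_derive x v f d <-> is_derive (0 : R) 1 (fun h : R => f (h *: v + x)) d.
Proof.
have dE : 'D_v f x = 'D_1 (fun h : R => f (h *: v + x)) 0.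
  rewrite /derive; set g1 := fun h => h^-1 *: _; set g2 := fun h => h^-1 *: _.
  suff -> : g1 = g2 by [].
  by apply/funext => h; rewrite /g1 /g2 /= addr0 scale0r add0r [_%:A]mulr1.
split=> -[fx fd]; split.
- exact: ((derivable1P f x v).1 fx).
- by rewrite -dE.
- exact: ((derivable1P f x v).2 fx).
- by rewrite dE.
Qed.

Lemma is_derive_comp1 (R : realType) (V : normedModType R) (f : V -> R)
    (g : R -> R) x v df dg :
  is_derive x v f df -> is_derive (f x) 1 g dg ->
  is_derive x v (g \o f) (dg * df).
Proof.
move=> /is_derive_line fd gd; apply/is_derive_line.
by apply: (@is_derive1_comp _ g _ 0) => //; rewrite scale0r add0r.
Qed.

Section Radial.
Variables (R : realType) (N : nat).
Implicit Types (x y v : 'rV[R]_N) (i j : 'I_N).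

Definition sqnorm x : R := \sum_(i < N) x 0 i ^+ 2.

Lemma is_derive_coord x v i : is_derive x v (fun y => y 0 i) (v 0 i).
Proof.
apply/is_derive_line.
have -> : (fun h : R => (h *: v + x) 0 i) = (fun h => h * v 0 i + x 0 i).
  by apply/funext => h; rewrite !mxE.
apply: is_derive_eq.
by rewrite /GRing.scale /=; ring.
Qed.

Lemma is_derive_sqnorm x i : is_derive x (delta_mx 0 i) sqnorm (2 * x 0 i).
Proof.
have -> : sqnorm = \sum_(j < N) ((fun y => y 0 j) ^+ 2 : 'rV[R]_N -> R).
  by apply/funext => y; rewrite fct_sumE.
have h := is_derive_sum (fun j => is_deriveX 2 (is_derive_coord x (delta_mx 0 i) j)).
apply: is_derive_eq h _.
rewrite (bigD1 i) //= big1 ?addr0 => [|j ji].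
  by rewrite mxE !eqxx /GRing.scale /=; ring.
by rewrite mxE (negbTE ji) andbF scaler0.
Qed.

Lemma continuous_sqnorm : continuous sqnorm.
Proof.
move=> x; rewrite /sqnorm.
have -> : (fun y : 'rV[R]_N => \sum_(i < N) y 0 i ^+ 2) =
   \sum_(i < N) (fun y : 'rV[R]_N => y 0 i ^+ 2).
  by apply/funext => y; rewrite fct_sumE.
apply: (big_ind (fun f : 'rV[R]_N -> R => {for x, continuous f})).
- exact: cst_continuous.
- by move=> f g cf cg; exact: continuousD.
- move=> i _; have ci := @coord_continuous _ _ _ (0 : 'I_1) i x.
  exact: (continuousM ci ci).
Qed.

Lemma sqnorm_ge0 x : 0 <= sqnorm x.
Proof. by apply: sumr_ge0 => i _; exact: sqr_ge0. Qed.

Lemma sqnorm_gt0 x : x != 0 -> 0 < sqnorm x.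
Proof.
move=> x0; rewrite lt_neqAle sqnorm_ge0 andbT eq_sym.
apply: contra x0; rewrite psumr_eq0 => [/allP h|i _]; last exact: sqr_ge0.
apply/eqP/rowP => i; rewrite mxE; apply/eqP.
by rewrite -sqrf_eq0; apply: h; rewrite mem_index_enum.
Qed.

Variables (G G1 G2 : R -> R) (d : R).
Hypothesis dG : forall t, 0 < t -> t < d -> is_derive t 1 G (G1 t).
Hypothesis dG1 : forall t, 0 < t -> t < d -> is_derive t 1 G1 (G2 t).
Hypothesis cG2 : forall t, 0 < t -> t < d -> {for t, continuous G2}.

Let near_annulus x : 0 < sqnorm x -> sqnorm x < d ->
  \forall y \near x, 0 < sqnorm y /\ sqnorm y < d.
Proof.
move=> x0 xd; have cx := @continuous_sqnorm x.
have h1 : \forall y \near x, 0 < sqnorm y := cx [set t | 0 < t] (lt_nbhsr x0).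
have h2 : \forall y \near x, sqnorm y < d := cx [set t | t < d] (lt_nbhsl xd).
by near=> y; split; near: y.
Unshelve. all: by end_near. Qed.

Lemma is_derive_radial x i : 0 < sqnorm x -> sqnorm x < d ->
  is_derive x (delta_mx 0 i) (G \o sqnorm) (G1 (sqnorm x) * (2 * x 0 i)).
Proof.
by move=> x0 xd; apply: is_derive_comp1; [exact: is_derive_sqnorm|exact: dG].
Qed.

Let partialE x i : 0 < sqnorm x -> sqnorm x < d ->
  \forall y \near x,
    G1 (sqnorm y) * (2 * y 0 i) = partial i (G \o sqnorm) y.
Proof.
move=> x0 xd; near=> y.
have [y0 yd] : 0 < sqnorm y /\ sqnorm y < d by near: y; exact: near_annulus.
by rewrite /partial; have [_ ->] := is_derive_radial i y0 yd.
Unshelve. all: by end_near. Qed.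

Lemma is_derive_partial_radial x i j : 0 < sqnorm x -> sqnorm x < d ->
  is_derive x (delta_mx 0 j) (partial i (G \o sqnorm))
    (G2 (sqnorm x) * (4 * x 0 i * x 0 j) + 2 * (i == j)%:R * G1 (sqnorm x)).
Proof.
move=> x0 xd; apply: near_eq_is_derive (partialE i x0 xd) _.
have d1 : is_derive x (delta_mx 0 j) (G1 \o sqnorm) (G2 (sqnorm x) * (2 * x 0 j)).
  by apply: is_derive_comp1; [exact: is_derive_sqnorm|exact: dG1].
have d2 : is_derive x (delta_mx 0 j) (fun y : 'rV[R]_N => 2 * y 0 i) (2 * (i == j)%:R).
  apply: is_derive_eq (is_deriveZ 2 (is_derive_coord x (delta_mx 0 j) i)) _.
  by rewrite mxE eqxx.
apply: is_derive_eq (is_deriveM d1 d2) _.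
by rewrite /GRing.scale /=; ring.
Qed.

Let partial2E x i j : 0 < sqnorm x -> sqnorm x < d ->
  \forall y \near x,
    G2 (sqnorm y) * (4 * y 0 i * y 0 j) + 2 * (i == j)%:R * G1 (sqnorm y)
    = partial j (partial i (G \o sqnorm)) y.
Proof.
move=> x0 xd; near=> y.
have [y0 yd] : 0 < sqnorm y /\ sqnorm y < d by near: y; exact: near_annulus.
by rewrite [RHS]/partial; have [_ ->] := is_derive_partial_radial i j y0 yd.
Unshelve. all: by end_near. Qed.

Let near_continuous (f g : 'rV[R]_N -> R) x :
  (\forall y \near x, f y = g y) -> {for x, continuous f} -> {for x, continuous g}.
Proof.
move=> fg cf; have e : f x = g x := nbhs_singleton fg.
rewrite /prop_for /continuous_at -e.
exact: cvg_trans (near_eq_cvg fg) cf.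
Qed.

Let continuous_derive (f : R -> R) (t e : R) :
  is_derive t 1 f e -> {for t, continuous f}.
Proof.
by move=> [fd _]; apply: differentiable_continuous; exact/derivable1_diffP.
Qed.

Lemma C2_at_radial x : 0 < sqnorm x -> sqnorm x < d -> C2_at (G \o sqnorm) x.
Proof.
move=> x0 xd; have cx := @continuous_sqnorm x.
have cG1 : {for x, continuous (G1 \o sqnorm)}.
  by apply: continuous_comp => //; exact: continuous_derive (dG1 x0 xd).
have cG2' : {for x, continuous (G2 \o sqnorm)}.
  by apply: continuous_comp => //; exact: cG2.
have cc i : {for x, continuous (fun y : 'rV[R]_N => y 0 i)} by exact: coord_continuous.
have ck (c : R) : {for x, continuous (fun _ : 'rV[R]_N => c)} by exact: cst_continuous.
split; first by apply: continuous_comp => //; exact: continuous_derive (dG x0 xd).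
move=> i; split.
- by have [] := is_derive_radial i x0 xd.
- apply: near_continuous (partialE i x0 xd) _.
  exact: (continuousM cG1 (continuousM (ck 2) (cc i))).
- move=> j; split; first by have [] := is_derive_partial_radial i j x0 xd.
  apply: near_continuous (partial2E i j x0 xd) _.
  exact: (continuousD (continuousM cG2' (continuousM (continuousM (ck 4) (cc i)) (cc j)))
    (continuousM (ck _) cG1)).
Qed.

Lemma laplacian_radial x : 0 < sqnorm x -> sqnorm x < d ->
  laplacian (G \o sqnorm) x =
  4 * sqnorm x * G2 (sqnorm x) + 2 * N%:R * G1 (sqnorm x).
Proof.
move=> x0 xd; rewrite /laplacian.
have e i : partial i (partial i (G \o sqnorm)) x =
    4 * x 0 i ^+ 2 * G2 (sqnorm x) + 2 * G1 (sqnorm x).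
  rewrite {1}/partial; have [_ ->] := is_derive_partial_radial i i x0 xd.
  by rewrite eqxx mulr1; ring.
under eq_bigr do rewrite e.
rewrite big_split /= sumr_const card_ord -mulr_suml -mulr_sumr.
by rewrite -[_ *+ N]mulr_natl -/(sqnorm x); ring.
Qed.

End Radial.

(** * The rupture solution *)

Section Rupture.
Variable R : realType.

(** The factor by which the Laplacian multiplies [r^e], up to [r^(-2)], for the
    n-th exponent [e] of the expansion. *)
Definition laplace_symbol (N : nat) (p alpha : R) (n : nat) : R :=
  expo p alpha n * (expo p alpha n + N%:R - 2).

(** The coefficients of [Y], as functions of [d1]: [F] occurs only through
    [d1]. *)
Definition rupture_coef (N : nat) (lambda p alpha d1 : R) : nat -> R :=
  ycoef p (laplace_symbol N p alpha 0) (d1 / Lambda N lambda p alpha)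
    (laplace_symbol N p alpha).

(** As the first exponent is 2, the denominator is [2 N + p kap]; it does not
    involve [lambda]. *)
Definition first_coef (F p alpha : R) (N : nat) : R :=
  F / (laplace_symbol N p alpha 1 + p * laplace_symbol N p alpha 0).

Lemma enormE (N : nat) (x : 'rV[R]_N) : enorm x = sqnorm x `^ 2^-1.
Proof. by rewrite powR12_sqrt ?sqnorm_ge0. Qed.

Lemma near0_sqnorm (N : nat) (e : R) : 0 < e ->
  \forall x \near (0 : 'rV[R]_N), sqnorm x < e.
Proof.
move=> e0; have s0 : sqnorm (0 : 'rV[R]_N) = 0.
  by rewrite /sqnorm big1 // => i _; rewrite mxE expr0n.
have c0 := @continuous_sqnorm R N 0.
by apply: (c0 [set t | t < e]); rewrite s0; exact: lt_nbhsl.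
Qed.

Lemma near_right_powR_lt (a e : R) : 0 < a -> 0 < e ->
  \forall t \near 0^'+, t `^ a < e.
Proof.
move=> a0 e0; have := powR_cvg0 a0.
by move=> /(_ [set y | y < e]) /(_ (lt_nbhsl e0)).
Qed.

Variables (N : nat) (lambda p F alpha : R).
Hypothesis N2 : (2 <= N)%N.
Hypothesis lambda0 : 0 < lambda.
Hypothesis p0 : 0 < p.
Hypothesis alpha_gt : -2 < alpha.
Hypothesis alpha_lt : alpha < 2 * p.

Let beta := (alpha + 2) / (p + 1).
Let sigma := (2 * p - alpha) / (p + 1).
Let q := laplace_symbol N p alpha.
Let kap := q 0.
Let Lam := Lambda N lambda p alpha.
Let d1 := first_coef F p alpha N.
Let y := rupture_coef N lambda p alpha d1.
Let z := zcoef p kap (d1 / Lam) q.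

Let beta0 : 0 < beta.
Proof.
rewrite /beta; have p0' := p0; have ag := alpha_gt.
by apply: divr_gt0; lra.
Qed.

Let sigma0 : 0 < sigma.
Proof.
rewrite /sigma; have p0' := p0; have ag := alpha_lt.
by apply: divr_gt0; lra.
Qed.

Let beta_sigma : beta + sigma = 2.
Proof.
by have p0' := p0; rewrite /beta /sigma; field; rewrite gt_eqF //; lra.
Qed.

Let expoE n : expo p alpha n = beta + sigma * n%:R.
Proof. by rewrite /expo /beta /sigma; ring. Qed.

Let N2R : 2 <= N%:R :> R. Proof. by rewrite (ler_nat R 2). Qed.

Let expo0 n : beta <= expo p alpha n.
Proof. by rewrite expoE lerDl mulr_ge0 // ltW. Qed.

Let q_gt0 n : 0 < q n.
Proof.
rewrite /q /laplace_symbol; have e0 := lt_le_trans beta0 (expo0 n).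
by apply: mulr_gt0 => //; have := N2R; lra.
Qed.

(** The exponents grow linearly, so [q n >= (sigma n)^2], and
    [n (n + 1) <= 2 n^2]. *)
Let q_ge n : sigma ^+ 2 / 2 * (n%:R * n.+1%:R) <= q n.
Proof.
have -> : n.+1%:R = n%:R + 1 :> R by rewrite natr1.
have n0 : 0 <= n%:R :> R by [].
have s0 := sigma0; have b0 := beta0; have N2' := N2R.
rewrite /q /laplace_symbol expoE.
have h1 : 0 <= sigma * n%:R by rewrite mulr_ge0 // ltW.
apply: (@le_trans _ _ ((sigma * n%:R) ^+ 2)); last by nra.
case: n n0 h1 => [|n] n0 h1; first by rewrite mul0r !mulr0 expr0n.
have n1 : 1 <= n.+1%:R :> R by rewrite ler1n.
have -> : sigma ^+ 2 / 2 * (n.+1%:R * (n.+1%:R + 1)) =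
  (sigma ^+ 2 * n.+1%:R) * ((n.+1%:R + 1) / 2) by ring.
have -> : (sigma * n.+1%:R) ^+ 2 = (sigma ^+ 2 * n.+1%:R) * n.+1%:R by ring.
apply: ler_wpM2l; last lra.
by rewrite mulr_ge0 // sqr_ge0.
Qed.

Let kapE : kap = beta * (beta + N%:R - 2).
Proof. by rewrite /kap /q /laplace_symbol expoE mulr0 addr0. Qed.

Let kap0 : 0 < kap. Proof. exact: q_gt0. Qed.

Let LamE : Lam = (lambda / kap) `^ (1 / (p + 1)).
Proof. by rewrite kapE. Qed.

Lemma Lambda_gt0 : 0 < Lam.
Proof. by rewrite LamE powR_gt0 // divr_gt0. Qed.

Let Lam0 := Lambda_gt0.

(** The equality of the constant terms of the equation, which singles out the
    value of [Lambda]. *)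
Let Lam_pow : Lam * kap = lambda / Lam `^ p.
Proof.
have p1 : p + 1 != 0 by have p0' := p0; rewrite gt_eqF //; lra.
have h : Lam `^ p * Lam = lambda / kap.
  rewrite -[X in _ * X]powRr1 ?(ltW Lam0) // -powRD; last first.
    by rewrite (gt_eqF Lam0) implybT.
  by rewrite LamE -powRrM divfK // powRr1 // ltW // divr_gt0.
have P0 : Lam `^ p != 0 by rewrite gt_eqF // powR_gt0.
apply: (mulIf P0); rewrite divfK // mulrAC [Lam * _]mulrC h divfK //.
by rewrite gt_eqF.
Qed.

Let q1E : (q 1 + p * kap) * (d1 / Lam) = F / Lam.
Proof.
rewrite /d1 /first_coef -/q -/kap mulrA [_ * (F / _)]mulrC divfK //.
by rewrite gt_eqF // addr_gt0 //; exact: mulr_gt0.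
Qed.

Let tau := sigma / 2.
Let b := beta / 2.
Let dy k := (b + tau * k%:R) * y k.
Let ddy k := (b - 1 + tau * k%:R) * dy k.
Let G t := Lam * pprofile tau b y t.
Let G1 t := Lam * pprofile tau (b - 1) dy t.
Let G2 t := Lam * pprofile tau (b - 1 - 1) ddy t.

Definition rupture_profile (r : R) : R := Lam * r `^ beta * psum y (r `^ sigma).

Let rupture_profile_enorm : rupture_profile \o enorm = G \o @sqnorm R N.
Proof.
apply/funext => x /=; rewrite /rupture_profile /G /pprofile enormE -!powRrM.
by rewrite ![2^-1 * _]mulrC mulrA.
Qed.

Let radius_dy (r : R) : radius_ge r y -> radius_ge r dy.
Proof.
move=> ry; have := radiusD (radiusZ b ry) (radiusZ tau (radius_mulk ry)).
by rewrite /dy; under [X in _ -> radius_ge _ X]eq_fun do rewrite mulrDl -mulrA.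
Qed.

Let radius_ddy (r : R) : radius_ge r y -> radius_ge r ddy.
Proof.
move=> /radius_dy ry; have := radiusD (radiusZ (b - 1) ry) (radiusZ tau (radius_mulk ry)).
by rewrite /ddy; under [X in _ -> radius_ge _ X]eq_fun do rewrite mulrDl -mulrA.
Qed.

(** With [e = b + tau k], the combination [4 t G'' + 2 N G'] multiplies [t^e] by
    [4 e (e - 1) + 2 N e = 2 e (2 e + N - 2)], up to [t^(-1)]; as [2 e] is the
    k-th exponent, this is [q k]. *)
Let ddyE k : 4 * ddy k + 2 * N%:R * dy k =
  kap * z k + (k == 1%N)%:R * (F / Lam).
Proof.
have := @coef_ode R p kap (d1 / Lam) q p0 kap0 q_gt0 k erefl.
rewrite q1E => <-.
rewrite /ddy /dy /q /laplace_symbol expoE /tau /b -/y.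
by rewrite -/(ycoef _ _ _ _ _) /y /rupture_coef -/Lam -/q -/kap; field.
Qed.

(** Both sides are [t^(b - 1)] times a series in [t^tau]. The identity
    [alpha / 2 - b p = b - 1] matches the nonlinear term, and [b - 1 + tau = 0]
    turns the term of index 1 into the constant [F]. *)
Let profile_ode (r t : R) : radius_ge r y -> radius_ge r z -> 0 < t ->
  t `^ tau < r -> 0 < psum y (t `^ tau) ->
  psum z (t `^ tau) = psum y (t `^ tau) `^ (- p) ->
  4 * t * G2 t + 2 * N%:R * G1 t =
    lambda * (t `^ 2^-1) `^ alpha / G t `^ p + F.
Proof.
move=> ry rz t0 tr Y0 zY; set s := t `^ tau in tr Y0 zY *.
have sr : `|s| < r by rewrite ger0_norm // powR_ge0.
have tD x w : t `^ (x + w) = t `^ x * t `^ w.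
  by rewrite powRD // (gt_eqF t0) implybT.
have tb : t * t `^ (b - 1 - 1) = t `^ (b - 1).
  by rewrite -[X in X * _]powRr1 ?(ltW t0) // -tD; congr (_ `^ _); ring.
have -> : 4 * t * G2 t + 2 * N%:R * G1 t =
    Lam * t `^ (b - 1) * (4 * psum ddy s + 2 * N%:R * psum dy s).
  by rewrite /G2 /G1 /pprofile -/s -tb; ring.
have ry1 := radius_dy ry; have ry2 := radius_ddy ry.
rewrite -(psumZ 4 ry2 sr) -(psumZ (2 * N%:R) ry1 sr).
rewrite -(psumD (radiusZ _ ry2) (radiusZ _ ry1) sr).
under [X in psum X]eq_fun do rewrite ddyE.
rewrite (psumD (radiusZ kap rz) (@radius_X R r _) sr) (psumZ kap rz sr) psum_X zY.
have -> : G t `^ p = Lam `^ p * t `^ (b * p) * psum y s `^ p.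
  rewrite /G /pprofile -/s powRM ?(ltW Lam0) ?mulr_ge0 ?powR_ge0 ?(ltW Y0) //.
  by rewrite powRM ?powR_ge0 ?(ltW Y0) // mulrA powRrM.
rewrite mulrDr; congr (_ + _).
  rewrite [(t `^ _) `^ _](_ : _ = t `^ (b - 1) * t `^ (b * p)).
    rewrite powRN.
    have -> : Lam * t `^ (b - 1) * (kap * (psum y s `^ p)^-1) =
      Lam * kap * t `^ (b - 1) * (psum y s `^ p)^-1 by ring.
    by rewrite Lam_pow; field; rewrite !gt_eqF // powR_gt0.
  rewrite -powRrM -tD; congr (_ `^ _).
  by have p0' := p0; rewrite /b /beta; field; rewrite gt_eqF //; lra.
have -> : Lam * t `^ (b - 1) * (F / Lam * s) = F * (t `^ (b - 1) * s).
  by field; rewrite gt_eqF.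
rewrite -tD (_ : _ + _ = 0) ?powRr0 ?mulr1 // /b /tau.
by have := beta_sigma; lra.
Qed.


Let yz_radius : exists r, [/\ 0 < r, radius_ge r y & radius_ge r z].
Proof. by apply: coef_radius q_ge => //; rewrite divr_gt0 // exprn_gt0. Qed.

Let y0 : y 0%N = 1. Proof. exact: ycoef0. Qed.

Let tau0 : 0 < tau. Proof. by rewrite divr_gt0. Qed.

(** On a small ball around 0 the series converge, [Y > 0] and [Z = Y^(-p)];
    outside 0 the profile is then a smooth function of the sum of squares, and
    [profile_ode] applies. *)
Lemma rupture_profile_solution :
  rupture_solution lambda p F alpha (rupture_profile \o @enorm R N).
Proof.
have [r [r0 ry rz]] := yz_radius.
have [d [d0 dr yz]] := psum_powRN r0 ry rz y0 (zcoef0 _ _ _ _)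
  (@coef_conv R p kap (d1 / Lam) q).
(* The ball [|x|^2 < e] is the set where [(|x|^2)^tau < d]. *)
pose e := d `^ tau^-1.
have e0 : 0 < e by rewrite powR_gt0.
have small t : 0 < t -> t < e -> t `^ tau < d.
  move=> t0 te.
  have -> : d = e `^ tau by rewrite /e -powRrM mulVf ?gt_eqF // powRr1 // ltW.
  by rewrite gt0_ltr_powR // nnegrE ltW.
have dG t : 0 < t -> t < e -> is_derive t 1 G (G1 t).
  move=> t0 te; apply: (is_deriveZ Lam).
  exact: (is_derive_pprofile b ry t0 (lt_le_trans (small t t0 te) dr)).
have dG1 t : 0 < t -> t < e -> is_derive t 1 G1 (G2 t).
  move=> t0 te; apply: (is_deriveZ Lam).
  exact: (is_derive_pprofile (b - 1) (radius_dy ry) t0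
    (lt_le_trans (small t t0 te) dr)).
have cG2 t : 0 < t -> t < e -> {for t, continuous G2}.
  move=> t0 te; apply: differentiable_continuous; apply/derivable1_diffP.
  have h := is_deriveZ Lam (is_derive_pprofile (b - 1 - 1) (radius_ddy ry) t0
    (lt_le_trans (small t t0 te) dr)).
  by case: h.
rewrite rupture_profile_enorm; split.
  rewrite /G /pprofile /= (_ : sqnorm 0 = 0).
    by rewrite powR0 ?mul0r ?mulr0 // gt_eqF // divr_gt0.
  by rewrite /sqnorm big1 // => i _; rewrite mxE expr0n.
near=> x => x0.
have sx0 := sqnorm_gt0 x0.
have sxe : sqnorm x < e by near: x; exact: near0_sqnorm.
have [Y0 zY] := yz (sqnorm x `^ tau) (powR_ge0 _ _) (small _ sx0 sxe).
split.
- exact: C2_at_radial dG dG1 cG2 _ sx0 sxe.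
- by rewrite /G /pprofile /= !mulr_gt0 // powR_gt0.
- rewrite (laplacian_radial dG dG1 sx0 sxe) enormE.
  exact: profile_ode ry rz sx0 (lt_le_trans (small _ sx0 sxe) dr) Y0 zY.
Unshelve. all: by end_near. Qed.

Let near_small (r : R) : 0 < r -> \forall t \near 0^'+, `|t `^ sigma| <= r.
Proof.
move=> r0; near=> t; rewrite ger0_norm ?powR_ge0 // ltW //.
by near: t; exact: near_right_powR_lt.
Unshelve. all: by end_near. Qed.

Let powR_expo (n : nat) (t : R) : 0 < t ->
  t `^ expo p alpha n = t `^ beta * (t `^ sigma) ^+ n.
Proof.
move=> t0; rewrite expoE powRD ?(gt_eqF t0) ?implybT // powRrM.
by rewrite powR_mulrn // powR_ge0.
Qed.

Lemma rupture_profile_expansion :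
  has_expansion N lambda p alpha (fun i => Lam * y i) rupture_profile.
Proof.
move=> n n1; have [r [r0 ry _]] := yz_radius.
have [D D0 tail] := psum_tail n.+1 r0 ry.
apply/eqO_exP; exists (Lam * D); first exact: mulr_gt0.
near=> t; have t0 : 0 < t by [].
have ts : `|t `^ sigma| <= r / 4 by near: t; apply: near_small; rewrite divr_gt0.
have -> : rupture_profile t - partial_expansion N lambda p alpha (fun i => Lam * y i) n t
    = Lam * t `^ beta * (psum y (t `^ sigma) - \sum_(k < n.+1) y k * (t `^ sigma) ^+ k).
  rewrite /rupture_profile /partial_expansion -/Lam -/beta mulrBr; congr (_ - _).
  rewrite -(big_mkord predT (fun k => y k * (t `^ sigma) ^+ k)) [in RHS]big_ltn //.
  rewrite mulrDr y0 expr0 !mulr1; congr (_ + _).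
  rewrite mulr_sumr; apply: eq_bigr => i _.
  by rewrite powR_expo //; ring.
rewrite normrM (gtr0_norm (mulr_gt0 Lam0 (powR_gt0 _ t0))).
rewrite powR_expo // normrM (ger0_norm (powR_ge0 t beta)) normrX.
have := ler_wpM2l (mulr_ge0 (ltW Lam0) (powR_ge0 t beta)) (tail _ ts).
by move/le_trans; apply; rewrite le_eqVlt; apply/orP; left; apply/eqP; ring.
Unshelve. all: by end_near. Qed.

Lemma rupture_profile_leading_order :
  has_leading_order N lambda p alpha rupture_profile.
Proof.
have [r [r0 ry _]] := yz_radius; have [D D0 tail] := psum_tail 1 r0 ry.
exists (fun t => psum y (t `^ sigma) - 1).
  apply/eqO_exP; exists D => //; near=> t.
  have ts : `|t `^ sigma| <= r / 4 by near: t; apply: near_small; rewrite divr_gt0.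
  by have := tail _ ts; rewrite big_ord1 y0 expr0 mulr1 expr1.
by near=> t; rewrite /rupture_profile -/beta; congr (_ * _); rewrite addrC subrK.
Unshelve. all: by end_near. Qed.

End Rupture.

Set Strict Implicit.
Unset Implicit Arguments.

Theorem theorem1p1 (R : realType) :
  exists (D1 : R -> R -> R -> nat -> R)
         (D : nat -> R -> R -> nat -> R -> R -> R),
  forall (N : nat) (lambda p F alpha : R),
    (2 <= N)%N -> 0 < lambda -> 0 < p -> F != 0 ->
    -2 < alpha -> alpha < 2 * p ->
    exists (u : 'rV[R]_N -> R) (v : R -> R) (d : nat -> R),
      [/\ rupture_solution lambda p F alpha u,
          radial_near0 u v,
          has_expansion N lambda p alpha d v,
          has_leading_order N lambda p alpha v &
          coef_dependence D1 D N lambda p F alpha d].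
Proof.
exists (@first_coef R).
exists (fun i p alpha N lambda d1 =>
  Lambda N lambda p alpha * rupture_coef N lambda p alpha d1 i).
move=> N lambda p F alpha N2 lambda0 p0 _ alpha_gt alpha_lt.
pose v := rupture_profile N lambda p F alpha.
pose d1 := first_coef F p alpha N.
pose d i := Lambda N lambda p alpha * rupture_coef N lambda p alpha d1 i.
have d1E : d 1%N = d1.
  rewrite /d /rupture_coef ycoef1 mulrC divfK // gt_eqF //.
  exact: Lambda_gt0.
exists (v \o enorm), v, d; split.
- exact: rupture_profile_solution.
- by near=> x.
- exact: rupture_profile_expansion.
- exact: rupture_profile_leading_order.
- by split=> // i _; rewrite d1E.
Unshelve. all: by end_near. Qed.
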